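(* Let $(A,A_r^* )$ be a factorizable dendriform D-bialgebra. Then $\mathrm{Im}(r_+\oplus r_-)=\{(r_+(\xi),r_-(\xi)) : \xi\in A^*\}$ is a dendriform subalgebra of the direct sum dendriform algebra $A\oplus A$ (with componentwise products), and it is isomorphic to the dendriform algebra $(A^*,\prec_r,\succ_r)$. Moreover, any $x\in A$ has a unique decomposition $$x=x_+-x_-,\qquad (x_+,x_-)\in \mathrm{Im}(r_+\oplus r_-).$$
   Context: All vector spaces are finite-dimensional over a field $\mathbb{K}$ of characteristic different from $2$. A dendriform algebra $(A,\prec_A,\succ_A)$ is a vector space with two bilinear products such that, with $x\ast y=x\prec_A y+x\succ_A y$, for all $x,y,z$: $(x\prec_A y)\prec_A z=x\prec_A(y\ast z)$, $(x\succ_A y)\prec_A z=x\succ_A(y\prec_A z)$, $x\succ_A(y\succ_A z)=(x\ast y)\succ_A z$. Put $L_{\succ_A}(x)y=x\succ_A y$, $L_{\prec_A}(x)y=x\prec_A y$, $R_{\succ_A}(x)y=y\succ_A x$, $R_{\prec_A}(x)y=y\prec_A x$, $\mathcal{L}_A=L_{\prec_A}+L_{\succ_A}$, $\mathcal{R}_A=R_{\prec_A}+R_{\succ_A}$. For $F:A\to\mathfrak{gl}(A)$ define $F^*:A\to\mathfrak{gl}(A^* )$ by $\langle F^*(x)\xi,y\rangle=\langle\xi,F(x)y\rangle$ (no sign). For $r=\sum_i a_i\otimes b_i\in A\otimes A$, define $r_+,r_-:A^*\to A$ by $r(\xi,\eta)=\langle r_+(\xi),\eta\rangle=\langle\xi,r_-(\eta)\rangle$,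 and $I=r_+-r_-$. With the flip $\sigma(x\otimes y)=y\otimes x$, the skew-symmetric part of $r$ is $a=\frac12(r-\sigma(r))$. An element $s\in A\otimes A$ is $(L_\succ,R_\prec)$-invariant if $(\mathrm{Id}\otimes\mathcal{L}_A(x)-R_{\prec_A}(x)\otimes\mathrm{Id})s=0$ and $(\mathrm{Id}\otimes L_{\succ_A}(x)-\mathcal{R}_A(x)\otimes\mathrm{Id})\sigma(s)=0$ for all $x\in A$. The D-equation for $r$ is $$\sum_{i,j}(a_i\ast a_j)\otimes b_i\otimes b_j-\sum_{i,j}a_i\otimes a_j\otimes(b_i\prec_A b_j)-\sum_{i,j}a_j\otimes(a_i\succ_A b_j)\otimes b_i=0.$$ If $r$ satisfies the D-equation and $a$ is $(L_\succ,R_\prec)$-invariant, then $A^*$ is a dendriform algebra, denoted $A_r^*=(A^*,\prec_r,\succ_r)$, with $$\xi\succ_r\eta=\mathcal{R}_A^*(r_+(\xi))\eta-L_{\prec_A}^*(r_-(\eta))\xi,\qquad \xi\prec_r\eta=\mathcal{L}_A^*(r_+(\eta))\xi-R_{\succ_A}^*(r_-(\xi))\eta,$$ and the pair $(A,A_r^* )$ is a dendriform D-bialgebra, called a quasi-triangular dendriform D-bialgebra (no further condition on $r$ is involved). It is called factorizable if moreover $a$ is nondegenerate, i.e. $I:A^*\to A$ is a linear isomorphism. *)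

(* Defs.v *)
From HB Require Import structures.
From mathcomp Require Import all_boot all_order all_algebra.

Set Implicit Arguments.
Unset Strict Implicit.
Unset Printing Implicit Defensive.

Set Warnings "-redundant-canonical-projection".

Import GRing.Theory.
Local Open Scope ring_scope.

Reserved Notation "x ≺ y" (at level 38, no associativity).
Reserved Notation "x ≻ y" (at level 38, no associativity).
Reserved Notation "x ∗ y" (at level 38, no associativity).
Reserved Notation "x ⊗ y" (at level 39, left associativity).

Section Bilinear.
Variables (K : fieldType) (U V W : lmodType K).

Definition bilin (f : U -> V -> W) : Prop :=
  (forall u, linear (f u)) /\ (forall v, linear (f^~ v)).

Lemma linear_sum_ext (T T' : lmodType K) (f : T -> T') (I : finType)
    (c : I -> K) (x : I -> T) :
  linear f -> f (\sum_i c i *: x i) = \sum_i c i *: f (x i).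
Proof.
move=> lf; pose fM := GRing.isLinear.Build _ _ _ _ f lf.
pose fL : {linear T -> T'} := HB.pack f fM.
rewrite -[f]/(fL : T -> T') linear_sum.
by apply: eq_bigr => i _; rewrite linearZ.
Qed.

End Bilinear.

(* The tensor product of two finite-dimensional spaces, in coordinates with   *)
(* respect to their canonical bases: the (i, j) entry is the coefficient of   *)
(* e_i ⊗ f_j.  [tlift] and [tliftE], with [tensor_sum], give its universal    *)
(* property, and everything below is defined through [tlift].                 *)
Definition tensor (K : fieldType) (V W : vectType K) : Type :=
  'M[K]_(\dim {:V}, \dim {:W}).
HB.instance Definition _ (K : fieldType) (V W : vectType K) :=
  Vector.copy (tensor V W) 'M[K]_(\dim {:V}, \dim {:W}).

Definition tens (K : fieldType) (V W : vectType K) (v : V) (w : W) :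
    tensor V W :=
  \matrix_(i, j) (coord (vbasis {:V}) i v * coord (vbasis {:W}) j w).
Notation "v ⊗ w" := (tens v w) : ring_scope.

Definition tlift (K : fieldType) (V W U : vectType K) (f : V -> W -> U)
    (t : tensor V W) : U :=
  \sum_i \sum_j t i j *: f (vbasis {:V})`_i (vbasis {:W})`_j.

Section TensorTheory.
Variables (K : fieldType) (V W : vectType K).

Lemma tens_bilin : bilin (@tens K V W).
Proof.
by split=> [v k x y|w k x y]; apply/matrixP=> i j;
  rewrite !mxE linearP /= ?mulrDr ?mulrDl ?mulrA // ![_ * k]mulrC.
Qed.

Lemma tlift_linear (U : vectType K) (f : V -> W -> U) : linear (tlift f).
Proof.
move=> k s t; rewrite /tlift scaler_sumr -big_split; apply: eq_bigr => i _ /=.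
rewrite scaler_sumr -big_split; apply: eq_bigr => j _ /=.
by rewrite !mxE scalerDl scalerA.
Qed.

HB.instance Definition _ (U : vectType K) (f : V -> W -> U) :=
  GRing.isLinear.Build K (tensor V W) U _ (tlift f) (tlift_linear f).

Lemma tliftE (U : vectType K) (f : V -> W -> U) (v : V) (w : W) :
  bilin f -> tlift f (v ⊗ w) = f v w.
Proof.
move=> [fr fl].
rewrite {2}(coord_vbasis (memvf v)) (linear_sum_ext _ _ (fl w)).
apply: eq_bigr => i _.
rewrite {2}(coord_vbasis (memvf w)) (linear_sum_ext _ _ (fr _)) scaler_sumr.
by apply: eq_bigr => j _; rewrite mxE scalerA.
Qed.

Lemma tlift_sum (U : vectType K) (f : V -> W -> U) n
    (v : 'I_n -> V) (w : 'I_n -> W) :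
  bilin f -> tlift f (\sum_i v i ⊗ w i) = \sum_i f (v i) (w i).
Proof.
by move=> bf; rewrite linear_sum; apply: eq_bigr => i _; apply: tliftE.
Qed.

Lemma tensor_sum (t : tensor V W) :
  t = \sum_i \sum_j t i j *: ((vbasis {:V})`_i ⊗ (vbasis {:W})`_j).
Proof.
apply/matrixP=> i j; rewrite summxE (bigD1 i) //= summxE (bigD1 j) //= !mxE.
have cb (T : vectType K) (k l : 'I_(\dim {:T})) :
  coord (vbasis {:T}) k (vbasis {:T})`_l = (k == l)%:R.
  by rewrite coord_free ?(basis_free (vbasisP _)) // eq_sym.
rewrite !cb !eqxx !mulr1 big1 ?big1 ?addr0 // => [k nk|k nk].
  by rewrite summxE big1 // => l _; rewrite !mxE !cb eq_sym (negPf nk) mul0r mulr0.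
by rewrite !mxE !cb eqxx eq_sym (negPf nk) !mulr0.
Qed.

End TensorTheory.

Definition tmap (K : fieldType) (V W V' W' : vectType K)
    (f : V -> V') (g : W -> W') : tensor V W -> tensor V' W' :=
  tlift (fun v w => f v ⊗ g w).

Definition flip (K : fieldType) (V W : vectType K) :
    tensor V W -> tensor W V :=
  tlift (fun v w => w ⊗ v).

Record dendriform_axioms (K : fieldType) (V : lmodType K)
    (prec succ : V -> V -> V) : Prop := DendriformAxioms {
  prec_bilin : bilin prec;
  succ_bilin : bilin succ;
  prec_prec : forall x y z,
    prec (prec x y) z = prec x (prec y z + succ y z);
  succ_prec : forall x y z, prec (succ x y) z = succ x (prec y z);
  succ_succ : forall x y z,
    succ x (succ y z) = succ (prec x y + succ x y) z
}.

HB.mixin Record Vector_isDendriform (K : fieldType) A of Vector K A := {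
  dprec : A -> A -> A;
  dsucc : A -> A -> A;
  dendP : dendriform_axioms dprec dsucc
}.

#[short(type="dendType")]
HB.structure Definition Dendriform (K : fieldType) :=
  {A of Vector_isDendriform K A & Vector K A}.

Notation "x ≺ y" := (dprec x y) : ring_scope.
Notation "x ≻ y" := (dsucc x y) : ring_scope.
Notation "x ∗ y" := (x ≺ y + x ≻ y) : ring_scope.

Definition dend_isomorphic (K : fieldType) (A B : dendType K) : Prop :=
  exists f : {linear A -> B},
    [/\ bijective f,
        forall x y, f (x ≺ y) = f x ≺ f y
      & forall x y, f (x ≻ y) = f x ≻ f y].

Section DirectSum.
Variables (K : fieldType) (A B : dendType K).

Definition sum_prec (p q : A * B) : A * B := (p.1 ≺ q.1, p.2 ≺ q.2).
Definition sum_succ (p q : A * B) : A * B := (p.1 ≻ q.1, p.2 ≻ q.2).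

Lemma sum_dendP : dendriform_axioms sum_prec sum_succ.
Proof.
case: (@dendP K A) => -[pr pl] [sr sl] ax1 ax2 ax3.
case: (@dendP K B) => -[pr' pl'] [sr' sl'] ax1' ax2' ax3'.
split.
- split=> [u k x y|u k x y]; rewrite /sum_prec /=; congr pair;
    by [apply: pr | apply: pr' | apply: pl | apply: pl'].
- split=> [u k x y|u k x y]; rewrite /sum_succ /=; congr pair;
    by [apply: sr | apply: sr' | apply: sl | apply: sl'].
- by move=> x y z; congr pair; [apply: ax1 | apply: ax1'].
- by move=> x y z; congr pair; [apply: ax2 | apply: ax2'].
- by move=> x y z; congr pair; [apply: ax3 | apply: ax3'].
Qed.

HB.instance Definition _ :=
  Vector_isDendriform.Build K (A * B)%type sum_dendP.

End DirectSum.

Section Subalgebra.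
Variables (K : fieldType) (D : dendType K) (U : {vspace D}).

Definition dend_subalgebra : Prop :=
  (forall x y, x \in U -> y \in U -> x ≺ y \in U) /\
  (forall x y, x \in U -> y \in U -> x ≻ y \in U).

Definition subdend (hU : dend_subalgebra) : Type := subvs_of U.

Variable hU : dend_subalgebra.
HB.instance Definition _ := Vector.on (subdend hU).

Definition sub_prec (u v : subdend hU) : subdend hU :=
  Subvs (hU.1 _ _ (subvsP u) (subvsP v)).
Definition sub_succ (u v : subdend hU) : subdend hU :=
  Subvs (hU.2 _ _ (subvsP u) (subvsP v)).

Lemma sub_dendP : dendriform_axioms sub_prec sub_succ.
Proof.
case: (@dendP K D) => -[pr pl] [sr sl] ax1 ax2 ax3.
split.
- by split=> [u k x y|u k x y]; apply: val_inj; [apply: pr | apply: pl].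
- by split=> [u k x y|u k x y]; apply: val_inj; [apply: sr | apply: sl].
- by move=> x y z; apply: val_inj; apply: ax1.
- by move=> x y z; apply: val_inj; apply: ax2.
- by move=> x y z; apply: val_inj; apply: ax3.
Qed.

HB.instance Definition _ :=
  Vector_isDendriform.Build K (subdend hU) sub_dendP.

End Subalgebra.

Notation dual A := 'Hom(A, GRing.regular _).

Section Operators.
Variables (K : fieldType) (A : dendType K).

Definition Lprec (x : A) : 'End(A) := linfun (fun y => x ≺ y).
Definition Lsucc (x : A) : 'End(A) := linfun (fun y => x ≻ y).
Definition Rprec (x : A) : 'End(A) := linfun (fun y => y ≺ x).
Definition Rsucc (x : A) : 'End(A) := linfun (fun y => y ≻ x).
Definition Lboth (x : A) : 'End(A) := Lprec x + Lsucc x.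
Definition Rboth (x : A) : 'End(A) := Rprec x + Rsucc x.

(* [linfun f] is only meaningful for linear [f], hence the next lemmas. *)
Lemma linfun_linear (V W : vectType K) (f : V -> W) : linear f -> linfun f =1 f.
Proof.
move=> lf x; pose fM := GRing.isLinear.Build _ _ _ _ f lf.
pose fL : {linear V -> W} := HB.pack f fM.
exact: (lfunE fL x).
Qed.

Lemma LprecE x y : Lprec x y = x ≺ y.
Proof. by rewrite linfun_linear //; case: (@dendP K A) => -[]. Qed.
Lemma LsuccE x y : Lsucc x y = x ≻ y.
Proof. by rewrite linfun_linear //; case: (@dendP K A) => _ []. Qed.
Lemma RprecE x y : Rprec x y = y ≺ x.
Proof. by rewrite linfun_linear //; case: (@dendP K A) => -[]. Qed.
Lemma RsuccE x y : Rsucc x y = y ≻ x.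
Proof. by rewrite linfun_linear //; case: (@dendP K A) => _ []. Qed.
Lemma LbothE x y : Lboth x y = x ∗ y.
Proof. by rewrite lfunE /= LprecE LsuccE. Qed.
Lemma RbothE x y : Rboth x y = y ∗ x.
Proof. by rewrite lfunE /= RprecE RsuccE. Qed.

Definition fstar (F : A -> 'End(A)) (x : A) (xi : dual A) : dual A :=
  (xi \o F x)%VF.

End Operators.

Section RMatrix.
Variables (K : fieldType) (A : dendType K).
Implicit Types (r s : tensor A A) (xi eta : dual A).

Definition tpair r xi eta : K^o := tlift (fun a b => xi a * eta b : K^o) r.

(* For r = Σ a_i ⊗ b_i: r_+(xi) = Σ <xi, a_i> b_i, r_-(eta) = Σ <eta, b_i> a_i. *)
Definition rplus r xi : A := tlift (fun a b => (xi a : K) *: b) r.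
Definition rminus r eta : A := tlift (fun a b => (eta b : K) *: a) r.

Lemma rplusP r xi eta : eta (rplus r xi) = tpair r xi eta.
Proof.
rewrite /rplus /tpair /tlift linear_sum; apply: eq_bigr => i _.
by rewrite linear_sum; apply: eq_bigr => j _; rewrite linearZ /= linearZ.
Qed.

Lemma rminusP r xi eta : xi (rminus r eta) = tpair r xi eta.
Proof.
rewrite /rminus /tpair /tlift linear_sum; apply: eq_bigr => i _.
rewrite linear_sum; apply: eq_bigr => j _; rewrite linearZ /= linearZ.
by congr (_ *: _); apply: mulrC.
Qed.

Lemma rplus_linear r : linear (rplus r).
Proof.
move=> k x y; rewrite /rplus /tlift scaler_sumr -big_split.
apply: eq_bigr => i _ /=; rewrite scaler_sumr -big_split.
apply: eq_bigr => j _ /=; rewrite !lfunE /= lfunE scalerDl scalerDr !scalerA.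
by congr (_ *: _ + _); rewrite mulrCA.
Qed.

Lemma rminus_linear r : linear (rminus r).
Proof.
move=> k x y; rewrite /rminus /tlift scaler_sumr -big_split.
apply: eq_bigr => i _ /=; rewrite scaler_sumr -big_split.
apply: eq_bigr => j _ /=; rewrite !lfunE /= lfunE scalerDl scalerDr !scalerA.
by congr (_ *: _ + _); rewrite mulrCA.
Qed.

Definition rdiff r xi : A := rplus r xi - rminus r xi.

Definition skew_part r : tensor A A := 2%:R^-1 *: (r - flip r).

Lemma tpair_flip r xi eta : tpair (flip r) xi eta = tpair r eta xi.
Proof.
rewrite /tpair.
have -> : flip r = \sum_i \sum_j r i j *:
  ((vbasis {:A})`_j ⊗ (vbasis {:A})`_i) by [].
rewrite linear_sum; apply: eq_bigr => i _.
rewrite linear_sum; apply: eq_bigr => j _; rewrite linearZ; congr (_ *: _).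
rewrite [LHS]tliftE; first exact: mulrC.
split=> [u k x y|v k x y]; rewrite /= linearP.
  by rewrite [LHS]mulrDr; congr (_ + _); apply: mulrCA.
by rewrite [LHS]mulrDl; congr (_ + _); rewrite -[LHS]mulrA.
Qed.

(* [rdiff r] is twice the map induced by the skew-symmetric part of [r]. *)
Lemma rdiffP r xi eta : (2%:R : K) != 0 ->
  eta (rdiff r xi) = (2%:R : K) *: tpair (skew_part r) xi eta.
Proof.
move=> nz2; rewrite /rdiff linearB /= rplusP rminusP -(tpair_flip r xi eta).
by rewrite /tpair /skew_part linearZ linearB /= scalerA divff // scale1r.
Qed.

Definition invariant s : Prop := forall x : A,
  tmap id (Lboth x) s - tmap (Rprec x) id s = 0 /\
  tmap id (Lsucc x) (flip s) - tmap (Rboth x) id (flip s) = 0.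

(* [tsum2 r f] is Σ_{i,j} f a_i b_i a_j b_j for r = Σ a_i ⊗ b_i. *)
Definition tsum2 (U : vectType K) r (f : A -> A -> A -> A -> U) : U :=
  tlift (fun ai bi => tlift (fun aj bj => f ai bi aj bj) r) r.

Lemma tsum2E (U : vectType K) (f : A -> A -> A -> A -> U) n
    (a b : 'I_n -> A) :
  (forall ai bi, bilin (f ai bi)) ->
  (forall aj bj, bilin (fun ai bi => f ai bi aj bj)) ->
  tsum2 (\sum_i a i ⊗ b i) f = \sum_i \sum_j f (a i) (b i) (a j) (b j).
Proof.
move=> f2 f1; rewrite /tsum2 tlift_sum.
  by apply: eq_bigr => i _; rewrite tlift_sum.
have lift_lin (g h k : A -> A -> U) c (t : tensor A A) :
    (forall x y, g x y = c *: h x y + k x y) ->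
    tlift g t = c *: tlift h t + tlift k t.
  move=> ghk; rewrite /tlift scaler_sumr -big_split; apply: eq_bigr => i _ /=.
  rewrite scaler_sumr -big_split; apply: eq_bigr => j _ /=.
  by rewrite ghk scalerDr !scalerA mulrC.
split=> [u c x y|v c x y]; apply: lift_lin => aj bj.
  by case: (f1 aj bj) => + _; apply.
by case: (f1 aj bj) => _; apply.
Qed.

Definition D_equation r : Prop :=
  tsum2 r (fun ai bi aj bj => (ai ∗ aj) ⊗ bi ⊗ bj)
  - tsum2 r (fun ai bi aj bj => ai ⊗ aj ⊗ (bi ≺ bj))
  - tsum2 r (fun ai bi aj bj => aj ⊗ (ai ≻ bj) ⊗ bi) = 0.

Lemma D_equationE n (a b : 'I_n -> A) :
  D_equation (\sum_i a i ⊗ b i) <->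
  \sum_i \sum_j (a i ∗ a j) ⊗ b i ⊗ b j
  - \sum_i \sum_j a i ⊗ a j ⊗ (b i ≺ b j)
  - \sum_i \sum_j a j ⊗ (a i ≻ b j) ⊗ b i = 0.
Proof.
case: (@dendP K A) => -[pr pl] [sr sl] _ _ _.
have [t1 t2] := @tens_bilin K A A.
have [t3 t4] := @tens_bilin K (tensor A A) A.
have dr (x : A) : linear (fun y : A => x ∗ y).
  by move=> k u v; rewrite pr sr scalerDr addrACA.
have dl (x : A) : linear (fun y : A => y ∗ x).
  by move=> k u v; rewrite (pl x) (sl x) scalerDr addrACA.
rewrite /D_equation !tsum2E //.
all: try by move=> u v; split=> [w k x y|w k x y];
  rewrite ?dr ?(dl, pr, sr) ?(pl _ k) ?(sl _ k) ?(dl _ k) ?t1 ?(t2 _ k) ?t3 ?(t4 _ k).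
Qed.

Definition quasi_triangular r : Prop :=
  D_equation r /\ invariant (skew_part r).

Definition factorizable r : Prop :=
  quasi_triangular r /\ bijective (rdiff r).

Definition succ_r r xi eta : dual A :=
  fstar (@Rboth K A) (rplus r xi) eta - fstar (@Lprec K A) (rminus r eta) xi.
Definition prec_r r xi eta : dual A :=
  fstar (@Lboth K A) (rplus r eta) xi - fstar (@Rsucc K A) (rminus r xi) eta.

Definition dual_dend r (hr : dendriform_axioms (prec_r r) (succ_r r)) : Type :=
  dual A.
HB.instance Definition _ r hr := Vector.on (@dual_dend r hr).
HB.instance Definition _ r hr :=
  Vector_isDendriform.Build K (@dual_dend r hr) hr.

Definition im_r r : {vspace A * A} :=
  limg (linfun (fun xi : dual A => (rplus r xi, rminus r xi))).

Lemma im_rP r (p : A * A) :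
  p \in im_r r <-> exists xi : dual A, p = (rplus r xi, rminus r xi).
Proof.
have lin : linear (fun xi : dual A => (rplus r xi, rminus r xi)).
  by move=> k x y; rewrite rplus_linear rminus_linear.
split=> [/memv_imgP[xi _ ->]|[xi ->]].
  by exists xi; rewrite linfun_linear.
by apply/memv_imgP; exists xi; rewrite ?memvf // linfun_linear.
Qed.

End RMatrix.

(* Main.v *)
(** Pairing the D-equation with xi, eta, zeta and the invariance of the
    skew-symmetric part with two functionals gives, for I = r_+ - r_-,
      <xi, r_- eta ∗ r_- zeta> = <zeta, r_+ xi ≺ r_+ eta> + <eta, r_- zeta ≻ r_+ xi>,
      <eta, x ∗ I xi> = - <xi, I eta ≺ x>,   <eta, x ≻ I xi> = - <xi, I eta ∗ x>,
    hence also <eta, x ≺ I xi> = <xi, I eta ≻ x>. These identities make r_+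
    and I, and so r_-, compatible with the products of A^*_r. As I is
    bijective, xi |-> (r_+ xi, r_- xi) is injective, so it transports the
    dendriform axioms from A ⊕ A to A^* and identifies A^* with its image; the
    decomposition of x is the one given by xi = I^-1 x. *)

Require Import Defs.
From HB Require Import structures.
From mathcomp Require Import all_boot all_order all_algebra.

Set Implicit Arguments.
Unset Strict Implicit.
Unset Printing Implicit Defensive.

Import GRing.Theory.
Local Open Scope ring_scope.

(** * Separation of points by functionals, and lifts under linear maps *)

Lemma dual_separates (K : fieldType) (V : vectType K) (u v : V) :
  (forall zeta : dual V, zeta u = zeta v) -> u = v.
Proof.
move=> uv; rewrite (coord_vbasis (memvf u)) (coord_vbasis (memvf v)).
apply: eq_bigr => i _; congr (_ *: _).
(* The coordinate maps of a basis, read as functionals, already separate points. *)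
by have := uv (linfun (coord (vbasis {:V}) i : V -> K^o)); rewrite !lfunE.
Qed.

Section TensorLift.
Variables (K : fieldType) (V W : vectType K).

Lemma eq_tlift (U : vectType K) (f g : V -> W -> U) (t : tensor V W) :
  f =2 g -> tlift f t = tlift g t.
Proof. by move=> fg; apply: eq_bigr => i _; apply: eq_bigr => j _; rewrite fg. Qed.

Lemma linear_tlift (U U' : vectType K) (h : U -> U') (f : V -> W -> U)
    (t : tensor V W) :
  linear h -> h (tlift f t) = tlift (fun v w => h (f v w)) t.
Proof.
move=> lh; rewrite -(linfun_linear lh) /tlift linear_sum.
apply: eq_bigr => i _; rewrite linear_sum; apply: eq_bigr => j _.
by rewrite linearZ /= linfun_linear.
Qed.

End TensorLift.

(** * Additivity of the products, and transport of the dendriform axioms *)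

Section Bilinearity.
Variables (K : fieldType) (A : dendType K).
Implicit Types x y z : A.

Lemma dprecDr x : {morph dprec x : y z / y + z}.
Proof. by move=> y z; rewrite -!LprecE linearD. Qed.
Lemma dprecDl x : {morph dprec^~ x : y z / y + z}.
Proof. by move=> y z; rewrite -!RprecE linearD. Qed.
Lemma dsuccDr x : {morph dsucc x : y z / y + z}.
Proof. by move=> y z; rewrite -!LsuccE linearD. Qed.
Lemma dsuccDl x : {morph dsucc^~ x : y z / y + z}.
Proof. by move=> y z; rewrite -!RsuccE linearD. Qed.

Lemma dmulDl x y z : (y + z) ∗ x = y ∗ x + z ∗ x.
Proof. by rewrite dprecDl dsuccDl addrACA. Qed.
Lemma dmulDr x y z : x ∗ (y + z) = x ∗ y + x ∗ z.
Proof. by rewrite dprecDr dsuccDr addrACA. Qed.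

End Bilinearity.

(** Applying [phi] to an axiom for [prec] and [succ] gives the same axiom in [D], and injectivity
    brings it back. *)
Lemma dendriform_axioms_inj (K : fieldType) (V : lmodType K) (D : dendType K)
    (prec succ : V -> V -> V) (phi : V -> D) :
  linear phi -> injective phi ->
  (forall x y, phi (prec x y) = phi x ≺ phi y) ->
  (forall x y, phi (succ x y) = phi x ≻ phi y) ->
  dendriform_axioms prec succ.
Proof.
move=> lphi inj hp hs.
have phiD x y : phi (x + y) = phi x + phi y.
  by have := lphi 1 x y; rewrite !scale1r.
case: (@dendP K D) => -[pr pl] [sr sl] ax1 ax2 ax3.
split.
- split=> [u k x y|u k x y]; apply: inj; rewrite !(hp, lphi); first exact: pr.
  exact: pl.
- split=> [u k x y|u k x y]; apply: inj; rewrite !(hs, lphi); first exact: sr.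
  exact: sl.
- by move=> x y z; apply: inj; rewrite !(hp, hs, phiD) ax1.
- by move=> x y z; apply: inj; rewrite !(hp, hs, phiD) ax2.
- by move=> x y z; apply: inj; rewrite !(hp, hs, phiD) ax3.
Qed.

(** * Pairings of tensors with functionals *)

Section QuasiTriangular.
Variables (K : fieldType) (A : dendType K).
Implicit Types (r s : tensor A A) (xi eta zeta : dual A) (x y : A).

Lemma tpair_linear xi eta : linear (fun s => tpair s xi eta).
Proof. exact: tlift_linear. Qed.

Lemma tpair_tens x y xi eta : tpair (x ⊗ y) xi eta = xi x * eta y.
Proof.
rewrite /tpair tliftE //; split=> [u k v w|u k v w]; rewrite /= linearP.
  by rewrite [LHS]mulrDr; congr (_ + _); apply: mulrCA.
by rewrite [LHS]mulrDl; congr (_ + _); rewrite -[LHS]mulrA.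
Qed.

Lemma tpair_tmap (f g : A -> A) s xi eta :
  tpair (tmap f g s) xi eta = tlift (fun a b => xi (f a) * eta (g b) : K^o) s.
Proof.
rewrite /tmap (linear_tlift _ _ (tpair_linear xi eta)).
by apply: eq_tlift => a b; apply: tpair_tens.
Qed.

Lemma rplus_rminus r xi eta : eta (rplus r xi) = xi (rminus r eta).
Proof. by rewrite rplusP rminusP. Qed.

Lemma rplusE r xi : rplus r xi = rminus r xi + rdiff r xi.
Proof. by rewrite /rdiff addrC subrK. Qed.

(** The maps r_+ and r_- are transposes of each other, so I is minus its own transpose. *)
Lemma rdiff_skew r xi eta : eta (rdiff r xi) = - xi (rdiff r eta).
Proof. by rewrite /rdiff !linearB /= !rplus_rminus opprK addrC. Qed.

Lemma succ_rE r xi eta x :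
  succ_r r xi eta x = eta (x ∗ rplus r xi) - xi (rminus r eta ≺ x).
Proof. by rewrite /succ_r /fstar add_lfunE opp_lfunE !comp_lfunE RbothE LprecE. Qed.

Lemma prec_rE r xi eta x :
  prec_r r xi eta x = xi (rplus r eta ∗ x) - eta (x ≻ rminus r xi).
Proof. by rewrite /prec_r /fstar add_lfunE opp_lfunE !comp_lfunE LbothE RsuccE. Qed.

(** * Triple pairings and the D-equation *)

Definition tpair3 (t : tensor (tensor A A) A) xi eta zeta : K^o :=
  tlift (fun s c => tpair s xi eta * zeta c : K^o) t.

Lemma tpair3_linear xi eta zeta : linear (fun t => tpair3 t xi eta zeta).
Proof. exact: tlift_linear. Qed.

Lemma tpair3_tens (a b c : A) xi eta zeta :
  tpair3 (a ⊗ b ⊗ c) xi eta zeta = xi a * eta b * zeta c.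
Proof.
rewrite /tpair3 tliftE ?tpair_tens //.
split=> [u k v w|u k v w] /=.
  by rewrite linearP [LHS]mulrDr; congr (_ + _); apply: mulrCA.
by rewrite tpair_linear [LHS]mulrDl; congr (_ + _); rewrite -[LHS]mulrA.
Qed.

Lemma tpair3_tsum2 r (f : A -> A -> A -> A -> tensor (tensor A A) A)
    xi eta zeta :
  tpair3 (tsum2 r f) xi eta zeta =
  tsum2 r (fun ai bi aj bj => tpair3 (f ai bi aj bj) xi eta zeta).
Proof.
rewrite /tsum2 (linear_tlift _ _ (tpair3_linear xi eta zeta)).
by apply: eq_tlift => a b; rewrite (linear_tlift _ _ (tpair3_linear xi eta zeta)).
Qed.

(** Serves to write a product of two values of r_+ or r_- as a double sum indexed like the terms of
    the D-equation. *)
Lemma tsum2_bilin (U : vectType K) r (m : A -> A -> U) (g h : A -> A -> A) :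
  bilin m ->
  m (tlift g r) (tlift h r) =
  tsum2 r (fun ai bi aj bj => m (g ai bi) (h aj bj)).
Proof.
move=> [mr ml]; rewrite (linear_tlift _ _ (ml _)); apply: eq_tlift => a b.
by rewrite (linear_tlift _ _ (mr _)).
Qed.

Lemma eq_tsum2 (U : vectType K) r (f g : A -> A -> A -> A -> U) :
  (forall a b c d, f a b c d = g a b c d) -> tsum2 r f = tsum2 r g.
Proof. by move=> fg; apply: eq_tlift => a b; apply: eq_tlift => c d. Qed.

Lemma bilin_scale (U : lmodType K) (m : A -> A -> U) (c d : K) x y :
  bilin m -> m (c *: x) (d *: y) = c *: (d *: m x y).
Proof.
move=> [mr ml]; have := ml (d *: y) c x 0; have := mr x d y 0.
(* [linear] is a single identity in k, x, y; k = -1 at zero vectors shows that zero goes to zero. *)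
have m0r u : m u 0 = 0 by have := mr u (-1) 0 0; rewrite scaler0 addr0 scaleN1r addNr.
have m0l u : m 0 u = 0 by have := ml u (-1) 0 0; rewrite scaler0 addr0 scaleN1r addNr.
by rewrite m0r m0l !addr0 => -> ->.
Qed.

Lemma pairing_prec_bilin xi : bilin (fun x y => xi (x ≺ y) : K^o).
Proof.
split=> u k x y; first by rewrite -!LprecE linearP linearP.
by rewrite /= -!RprecE linearP linearP.
Qed.

Lemma pairing_succ_bilin xi : bilin (fun x y => xi (x ≻ y) : K^o).
Proof.
split=> u k x y; first by rewrite -!LsuccE linearP linearP.
by rewrite /= -!RsuccE linearP linearP.
Qed.

Lemma pairing_mul_bilin xi : bilin (fun x y => xi (x ∗ y) : K^o).
Proof.
split=> u k x y; first by rewrite -!LbothE linearP linearP.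
by rewrite /= -!RbothE linearP linearP.
Qed.

(** In each term, two functionals are evaluated on legs outside the product: contracting a leg b_i
    leaves a value of r_-, contracting a leg a_i a value of r_+. *)
Lemma D_equation_pairing r xi eta zeta : D_equation r ->
  xi (rminus r eta ∗ rminus r zeta) =
  zeta (rplus r xi ≺ rplus r eta) + eta (rminus r zeta ≻ rplus r xi).
Proof.
move=> rD.
have -> : xi (rminus r eta ∗ rminus r zeta) =
    tpair3 (tsum2 r (fun ai bi aj bj => (ai ∗ aj) ⊗ bi ⊗ bj)) xi eta zeta.
  rewrite tpair3_tsum2 (tsum2_bilin r _ _ (pairing_mul_bilin xi)).
  apply: eq_tsum2 => a b c d; rewrite tpair3_tens.
  rewrite (bilin_scale _ _ _ _ (pairing_mul_bilin xi)).
  by rewrite [LHS]mulrA [LHS]mulrC [LHS]mulrA.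
have -> : zeta (rplus r xi ≺ rplus r eta) =
    tpair3 (tsum2 r (fun ai bi aj bj => ai ⊗ aj ⊗ (bi ≺ bj))) xi eta zeta.
  rewrite tpair3_tsum2 (tsum2_bilin r _ _ (pairing_prec_bilin zeta)).
  apply: eq_tsum2 => a b c d; rewrite tpair3_tens.
  rewrite (bilin_scale _ _ _ _ (pairing_prec_bilin zeta)).
  by rewrite [LHS]mulrA.
have -> : eta (rminus r zeta ≻ rplus r xi) =
    tpair3 (tsum2 r (fun ai bi aj bj => aj ⊗ (ai ≻ bj) ⊗ bi)) xi eta zeta.
  rewrite tpair3_tsum2 (tsum2_bilin r _ _ (pairing_succ_bilin eta)).
  apply: eq_tsum2 => a b c d; rewrite tpair3_tens.
  rewrite (bilin_scale _ _ _ _ (pairing_succ_bilin eta)).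
  by rewrite [LHS]mulrC.
(* As a linear map, [T] collects the three pairings into its value at the left side of the
   D-equation. *)
pose T := linfun (fun t => tpair3 t xi eta zeta).
have TE t : T t = tpair3 t xi eta zeta.
  by rewrite linfun_linear //; apply: tpair3_linear.
apply/eqP; rewrite -subr_eq0 opprD addrA -!TE -!linearB /=.
by move: rD; rewrite /D_equation => ->; rewrite linear0.
Qed.

(** * Invariance of the skew-symmetric part, read through I *)

Section Invariance.
Variable r : tensor A A.
Hypothesis nz2 : (2%:R : K) != 0.
Hypothesis r_inv : Defs.invariant (skew_part r).
Let I := rdiff r.

(** Paired with xi and eta, the first invariance condition moves [Lboth x] on the second leg to
    [Rprec x] on the first. Doubling turns the skew part into I, and skewness of I produces the
    sign. *)
Lemma invariant_Lboth xi eta x : eta (x ∗ I xi) = - xi (I eta ≺ x).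
Proof.
have [/eqP + _] := r_inv x; rewrite subr_eq0 => /eqP e.
have : tpair (skew_part r) xi (eta \o Lboth x)%VF =
       tpair (skew_part r) (xi \o Rprec x)%VF eta.
  have := congr1 (fun s => tpair s xi eta) e; rewrite /= !tpair_tmap => e'.
  rewrite /tpair; under eq_tlift => a b do rewrite comp_lfunE.
  by rewrite e'; apply: eq_tlift => a b; rewrite comp_lfunE.
move=> /(congr1 (fun c : K^o => (2%:R : K) *: c)); rewrite -!rdiffP //.
by rewrite (rdiff_skew r (_ \o _)%VF) !comp_lfunE LbothE RprecE.
Qed.

Lemma invariant_Lsucc xi eta x : eta (x ≻ I xi) = - xi (I eta ∗ x).
Proof.
have [_ /eqP] := r_inv x; rewrite subr_eq0 => /eqP e.
have : tpair (skew_part r) (eta \o Lsucc x)%VF xi =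
       tpair (skew_part r) eta (xi \o Rboth x)%VF.
  (* The second invariance condition concerns the flipped tensor, so the two functionals change
     places. *)
  rewrite -!(tpair_flip (skew_part r)).
  have := congr1 (fun s => tpair s xi eta) e; rewrite /= !tpair_tmap => e'.
  rewrite /tpair; under eq_tlift => a b do rewrite comp_lfunE.
  by rewrite e'; apply: eq_tlift => a b; rewrite comp_lfunE.
move=> /(congr1 (fun c : K^o => (2%:R : K) *: c)); rewrite -!rdiffP //.
by rewrite (rdiff_skew r (_ \o _)%VF) !comp_lfunE LsuccE RbothE => <-; rewrite opprK.
Qed.

Lemma invariant_Lprec xi eta x : eta (x ≺ I xi) = xi (I eta ≻ x).
Proof.
have := invariant_Lboth xi eta x.
rewrite (linearD eta) /= invariant_Lsucc (linearD xi) /= => /eqP.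
by rewrite subr_eq addrA addNr add0r => /eqP.
Qed.

End Invariance.

(** * Compatibility of r_+, I and r_- with the products *)

Section Morphisms.
Variable r : tensor A A.
Hypothesis nz2 : (2%:R : K) != 0.
Hypothesis r_qt : quasi_triangular r.
Let inv1 := invariant_Lboth nz2 r_qt.2.
Let inv2 := invariant_Lsucc nz2 r_qt.2.
Let inv3 := invariant_Lprec nz2 r_qt.2.

Lemma rplus_prec xi eta :
  rplus r (prec_r r xi eta) = rplus r xi ≺ rplus r eta.
Proof.
apply: dual_separates => zeta; rewrite rplus_rminus prec_rE.
have /eqP := D_equation_pairing xi eta zeta r_qt.1.
rewrite -subr_eq => /eqP <-.
(* With r_+ = r_- + I, the two sides differ by <xi, I eta ∗ r_- zeta> + <eta, r_- zeta ≻ I xi>,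
   which vanishes by [inv2]. *)
rewrite (rplusE r eta) (rplusE r xi) dmulDl dsuccDr.
rewrite (linearD xi) (linearD eta) /= inv2.
by rewrite opprD opprK addrAC addrA.
Qed.

Lemma rplus_succ xi eta :
  rplus r (succ_r r xi eta) = rplus r xi ≻ rplus r eta.
Proof.
apply: dual_separates => zeta; rewrite rplus_rminus succ_rE.
(* The functionals are permuted cyclically so that zeta is paired with a ≻ product. *)
have /eqP := D_equation_pairing eta zeta xi r_qt.1.
rewrite [X in _ == X]addrC -subr_eq => /eqP e.
rewrite {3}(rplusE r xi) dsuccDl (linearD zeta) /= -e -inv3.
(* Both sides are expanded by r_+ = r_- + I until <xi, I eta ≺ r_- zeta> occurs in each, on one side
   through [inv1]. *)
have -> : xi (rplus r eta ≺ rplus r zeta) =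
    xi (rdiff r eta ≺ rminus r zeta) + xi (rminus r eta ≺ rminus r zeta)
    + xi (rplus r eta ≺ rdiff r zeta).
  rewrite {1}(rplusE r zeta) dprecDr (linearD xi) /=; congr (_ + _).
  by rewrite (rplusE r eta) dprecDl (linearD xi) addrC.
have -> : eta (rminus r zeta ∗ rplus r xi) =
    eta (rminus r zeta ∗ rminus r xi) - xi (rdiff r eta ≺ rminus r zeta).
  by rewrite (rplusE r xi) dmulDr (linearD eta) /= inv1.
by rewrite !opprD !addrA subrK.
Qed.

Lemma rdiff_prec xi eta : rdiff r (prec_r r xi eta) =
  rplus r xi ≺ rplus r eta - rminus r xi ≺ rminus r eta.
Proof.
apply: dual_separates => zeta; rewrite rdiff_skew prec_rE opprB.
(* Invariance yields r_- xi ≺ I eta + I xi ≺ r_+ eta, which telescopes to the stated difference. *)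
rewrite inv1 opprK -inv3 -(linearD zeta) (rplusE r xi) dprecDl.
rewrite {2}(rplusE r eta) dprecDr addrAC.
by congr (zeta (_ + _)); rewrite [X in X - _]addrC addrK.
Qed.

Lemma rdiff_succ xi eta : rdiff r (succ_r r xi eta) =
  rplus r xi ≻ rplus r eta - rminus r xi ≻ rminus r eta.
Proof.
apply: dual_separates => zeta; rewrite rdiff_skew succ_rE opprB.
(* Here the telescoping sum is I xi ≻ r_- eta + r_+ xi ≻ I eta. *)
rewrite inv3 -inv2 -(linearD zeta) (rplusE r eta) dsuccDr.
rewrite {2}(rplusE r xi) dsuccDl addrAC.
by congr (zeta (_ + _)); rewrite [X in X - _]addrC addrK.
Qed.

Lemma rminus_prec xi eta :
  rminus r (prec_r r xi eta) = rminus r xi ≺ rminus r eta.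
Proof.
apply: (addIr (rdiff r (prec_r r xi eta))); rewrite -rplusE rplus_prec rdiff_prec.
by rewrite addrC subrK.
Qed.

Lemma rminus_succ xi eta :
  rminus r (succ_r r xi eta) = rminus r xi ≻ rminus r eta.
Proof.
apply: (addIr (rdiff r (succ_r r xi eta))); rewrite -rplusE rplus_succ rdiff_succ.
by rewrite addrC subrK.
Qed.

Definition rpair xi : A * A := (rplus r xi, rminus r xi).

Lemma rpair_linear : linear rpair.
Proof. by move=> k x y; rewrite /rpair rplus_linear rminus_linear. Qed.

Lemma rpair_prec xi eta : rpair (prec_r r xi eta) = rpair xi ≺ rpair eta.
Proof. by rewrite /rpair rplus_prec rminus_prec. Qed.

Lemma rpair_succ xi eta : rpair (succ_r r xi eta) = rpair xi ≻ rpair eta.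
Proof. by rewrite /rpair rplus_succ rminus_succ. Qed.

Lemma im_r_subalgebra : dend_subalgebra (im_r r).
Proof.
split=> x y /im_rP[xi ->] /im_rP[eta ->]; apply/im_rP.
  by exists (prec_r r xi eta); rewrite -[RHS]/(rpair _) rpair_prec.
by exists (succ_r r xi eta); rewrite -[RHS]/(rpair _) rpair_succ.
Qed.

End Morphisms.
End QuasiTriangular.

(** * The isomorphism with the image and the decomposition of elements *)

Theorem proposition2p20 (K : fieldType) (char_neq2 : 2%N \notin [pchar K])
    (A : dendType K) (r : tensor A A) (r_fact : factorizable r) :
  (exists (im_sub : dend_subalgebra (im_r r))
          (dual_ax : dendriform_axioms (prec_r r) (succ_r r)),
     dend_isomorphic (subdend im_sub) (dual_dend dual_ax)) /\
  (forall x : A, exists! p : A * A, p \in im_r r /\ x = p.1 - p.2).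
Proof.
have nz2 : (2%:R : K) != 0 by move: char_neq2; rewrite inE.
case: r_fact => r_qt [g gK Kg].
have rpair_inj : injective (rpair r).
  by move=> x y [ep em]; apply: (can_inj gK); rewrite /rdiff ep em.
split; last first.
  move=> x; exists (rpair r (g x)); split.
    by split; [apply/im_rP; exists (g x) | rewrite -[LHS]Kg].
  (* Any other pair comes from some xi with I xi = x, which forces xi = [g x]. *)
  by move=> _ [/im_rP[xi ->] ->]; rewrite -/(rdiff r xi) gK.
have dual_ax : dendriform_axioms (prec_r r) (succ_r r).
  exact: dendriform_axioms_inj (rpair_linear r) rpair_inj
    (rpair_prec nz2 r_qt) (rpair_succ nz2 r_qt).
pose im_sub := im_r_subalgebra nz2 r_qt; exists im_sub, dual_ax.
(* On the image the difference of the components is I xi, so [g] recovers xi. *)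
pose f (u : subdend im_sub) : dual_dend dual_ax := g ((vsval u).1 - (vsval u).2).
(* With injectivity of [rpair r], this reduces linearity and multiplicativity of [f] to those of
   [rpair r]. *)
have fK (u : subdend im_sub) : rpair r (f u) = vsval u.
  rewrite /f; have /im_rP[xi ->] := subvsP u.
  by rewrite /= -/(rdiff r xi) gK.
have f_lin : linear f.
  move=> k u v; apply: rpair_inj.
  by rewrite rpair_linear !fK.
pose fM := GRing.isLinear.Build _ _ _ _ f f_lin.
pose fL : {linear subdend im_sub -> dual_dend dual_ax} := HB.pack f fM.
exists fL; split.
- have im_rpair xi : rpair r xi \in im_r r by apply/im_rP; exists xi.
  exists (fun xi => Subvs (im_rpair xi) : subdend im_sub) => u.
    by apply: val_inj; apply: fK.
  by apply: rpair_inj; apply: fK.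
- by move=> x y; apply: rpair_inj; rewrite (rpair_prec nz2 r_qt) !fK.
- by move=> x y; apply: rpair_inj; rewrite (rpair_succ nz2 r_qt) !fK.
Qed.
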